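(* Let $\psi:\mathbb{W}\to\mathbb{S}$ be the bijection $$\psi(X_{\mathbf{1}},X_{\mathbf{i}},X_{\mathbf{j}},X_{\mathbf{k}})=\begin{bmatrix}X_{\mathbf{1}}&X_{\mathbf{i}}&X_{\mathbf{j}}&X_{\mathbf{k}}\\-X_{\mathbf{k}}&X_{\mathbf{1}}&X_{\mathbf{i}}&X_{\mathbf{j}}\\-X_{\mathbf{j}}&-X_{\mathbf{k}}&X_{\mathbf{1}}&X_{\mathbf{i}}\\-X_{\mathbf{i}}&-X_{\mathbf{j}}&-X_{\mathbf{k}}&X_{\mathbf{1}}\end{bmatrix},\qquad X_{\mathbf{1}},X_{\mathbf{i}},X_{\mathbf{j}},X_{\mathbf{k}}\in\mathbb{R}.$$ Then $\psi$ is an isomorphism of the algebras $\mathbb{W}$ and $\mathbb{S}$.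
   Context: $\mathbb{W}$ is the real algebra $\mathbb{R}^4$ with standard addition $\oplus$ and scalar multiplication, standard basis $\mathbf{1}=(1,0,0,0)$, $\mathbf{i}=(0,1,0,0)$, $\mathbf{j}=(0,0,1,0)$, $\mathbf{k}=(0,0,0,1)$, and multiplication, for $\mathbf{x}=(X_{\mathbf{1}},X_{\mathbf{i}},X_{\mathbf{j}},X_{\mathbf{k}})$ and $\mathbf{y}=(Y_{\mathbf{1}},Y_{\mathbf{i}},Y_{\mathbf{j}},Y_{\mathbf{k}})$, $$\mathbf{x}\otimes\mathbf{y}=(X_{\mathbf{1}}Y_{\mathbf{1}}-X_{\mathbf{i}}Y_{\mathbf{k}}-X_{\mathbf{j}}Y_{\mathbf{j}}-X_{\mathbf{k}}Y_{\mathbf{i}})\,\mathbf{1}\oplus(X_{\mathbf{1}}Y_{\mathbf{i}}+X_{\mathbf{i}}Y_{\mathbf{1}}-X_{\mathbf{j}}Y_{\mathbf{k}}-X_{\mathbf{k}}Y_{\mathbf{j}})\,\mathbf{i}\oplus(X_{\mathbf{1}}Y_{\mathbf{j}}+X_{\mathbf{i}}Y_{\mathbf{i}}+X_{\mathbf{j}}Y_{\mathbf{1}}-X_{\mathbf{k}}Y_{\mathbf{k}})\,\mathbf{j}\oplus(X_{\mathbf{1}}Y_{\mathbf{k}}+X_{\mathbf{i}}Y_{\mathbf{j}}+X_{\mathbf{j}}Y_{\mathbf{i}}+X_{\mathbf{k}}Y_{\mathbf{1}})\,\mathbf{k}.$$ $\mathbb{S}$ is the algebra, under the standard matrix operations,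 of skew circulant $4\times4$ real matrices $$\mathbb{S}=\left\{\begin{bmatrix}a&b&c&d\\-d&a&b&c\\-c&-d&a&b\\-b&-c&-d&a\end{bmatrix}\;:\;a,b,c,d\in\mathbb{R}\right\}.$$ *)

(* Defs.v *)
From HB Require Import structures.
From mathcomp Require Import all_boot all_order all_algebra.
From mathcomp Require Import boolp reals.
From mathcomp Require Import ring.

Set Implicit Arguments.
Unset Strict Implicit.
Unset Printing Implicit Defensive.

Import GRing.Theory.
Local Open Scope ring_scope.

(* The index literals 0, 1, 2, 3 in entries such as [x 0 2] live in the ring
   'I_4 of integers mod 4, so they denote the four distinct indices. *)

(* The carrier R^4; addition and scaling are those of row vectors. *)
Definition W (R : realType) : Type := 'rV[R]_4.

HB.instance Definition _ (R : realType) := GRing.Lmodule.on (W R).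

Section WAlgebra.
Variable R : realType.
Implicit Types x y z : W R.

Definition W1 : W R := delta_mx 0 0.
Definition Wi : W R := delta_mx 0 1.
Definition Wj : W R := delta_mx 0 2.
Definition Wk : W R := delta_mx 0 3.

Definition Wmul x y : W R :=
    (x 0 0 * y 0 0 - x 0 1 * y 0 3 - x 0 2 * y 0 2 - x 0 3 * y 0 1) *: W1
  + (x 0 0 * y 0 1 + x 0 1 * y 0 0 - x 0 2 * y 0 3 - x 0 3 * y 0 2) *: Wi
  + (x 0 0 * y 0 2 + x 0 1 * y 0 1 + x 0 2 * y 0 0 - x 0 3 * y 0 3) *: Wj
  + (x 0 0 * y 0 3 + x 0 1 * y 0 2 + x 0 2 * y 0 1 + x 0 3 * y 0 0) *: Wk.

Lemma Wext x y : x 0 0 = y 0 0 -> x 0 1 = y 0 1 -> x 0 2 = y 0 2 ->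
  x 0 3 = y 0 3 -> x = y.
Proof.
move=> e0 e1 e2 e3; apply/rowP => -[[|[|[|[|//]]]] lt_j4].
- by have -> : Ordinal lt_j4 = 0 by apply: val_inj.
- by have -> : Ordinal lt_j4 = 1 by apply: val_inj.
- by have -> : Ordinal lt_j4 = 2 by apply: val_inj.
- by have -> : Ordinal lt_j4 = 3 by apply: val_inj.
Qed.

Lemma WmulE x y :
  [/\ Wmul x y 0 0 =
        x 0 0 * y 0 0 - x 0 1 * y 0 3 - x 0 2 * y 0 2 - x 0 3 * y 0 1,
      Wmul x y 0 1 =
        x 0 0 * y 0 1 + x 0 1 * y 0 0 - x 0 2 * y 0 3 - x 0 3 * y 0 2,
      Wmul x y 0 2 =
        x 0 0 * y 0 2 + x 0 1 * y 0 1 + x 0 2 * y 0 0 - x 0 3 * y 0 3 &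
      Wmul x y 0 3 =
        x 0 0 * y 0 3 + x 0 1 * y 0 2 + x 0 2 * y 0 1 + x 0 3 * y 0 0].
Proof. by split; rewrite !mxE /= !(mulr0, mulr1, addr0, add0r). Qed.

Lemma W1E : [/\ W1 0 0 = 1, W1 0 1 = 0, W1 0 2 = 0 & W1 0 3 = 0].
Proof. by split; rewrite !mxE. Qed.

Lemma WmulA : associative Wmul.
Proof.
move=> x y z; have [a0 a1 a2 a3] := WmulE y z.
have [b0 b1 b2 b3] := WmulE x y; have [c0 c1 c2 c3] := WmulE x (Wmul y z).
have [d0 d1 d2 d3] := WmulE (Wmul x y) z.
by apply: Wext; rewrite ?(c0, c1, c2, c3) ?(d0, d1, d2, d3)
  ?(a0, a1, a2, a3) ?(b0, b1, b2, b3); ring.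
Qed.

Lemma WmulC : commutative Wmul.
Proof.
move=> x y; have [a0 a1 a2 a3] := WmulE x y; have [b0 b1 b2 b3] := WmulE y x.
by apply: Wext; rewrite ?(a0, a1, a2, a3) ?(b0, b1, b2, b3); ring.
Qed.

Lemma Wmul1 : left_id W1 Wmul.
Proof.
move=> x; have [a0 a1 a2 a3] := WmulE W1 x; have [b0 b1 b2 b3] := W1E.
by apply: Wext; rewrite ?(a0, a1, a2, a3) b0 b1 b2 b3; ring.
Qed.

Lemma WmulDl : left_distributive Wmul +%R.
Proof.
move=> x y z; have [a0 a1 a2 a3] := WmulE (x + y) z.
have [b0 b1 b2 b3] := WmulE x z; have [c0 c1 c2 c3] := WmulE y z.
by apply: Wext; rewrite ?(a0, a1, a2, a3) [RHS]mxE ?(b0, b1, b2, b3)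
  ?(c0, c1, c2, c3) !mxE; ring.
Qed.

Lemma W1_neq0 : W1 != 0.
Proof.
by apply/eqP => /(congr1 (fun x : W R => x 0 0))/eqP; rewrite !mxE /= oner_eq0.
Qed.

HB.instance Definition _ := GRing.Zmodule_isComNzRing.Build (W R)
  WmulA WmulC Wmul1 WmulDl W1_neq0.

Lemma WscaleAl (a : R) x y : a *: (x * y) = (a *: x) * y.
Proof.
have [a0 a1 a2 a3] := WmulE x y; have [b0 b1 b2 b3] := WmulE (a *: x) y.
by apply: Wext; rewrite [LHS]mxE ?(a0, a1, a2, a3) ?(b0, b1, b2, b3) !mxE; ring.
Qed.

HB.instance Definition _ := GRing.Lmodule_isLalgebra.Build R (W R) WscaleAl.
HB.instance Definition _ := GRing.Lalgebra_isComAlgebra.Build R (W R).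

End WAlgebra.

Section SkewCircAlgebra.
Variable R : realType.

Definition skew_circ (a b c d : R) : 'M[R]_4 :=
  \matrix_(r < 4, s < 4)
    nth 0 (nth [::] [:: [::   a;   b;   c; d];
                        [:: - d;   a;   b; c];
                        [:: - c; - d;   a; b];
                        [:: - b; - c; - d; a]] r) s.

Definition skew_circulant : {pred 'M[R]_4} :=
  fun M => `[< exists a b c d, M = skew_circ a b c d >].

Lemma skew_circulantP M :
  reflect (exists a b c d, M = skew_circ a b c d) (M \in skew_circulant).
Proof. exact: asboolP. Qed.

Lemma mem_skew_circ a b c d : skew_circ a b c d \in skew_circulant.
Proof. by apply/skew_circulantP; exists a, b, c, d. Qed.

Lemma skew_circulant_subalg : subalg_closed skew_circulant.
Proof.
split=> [|k _ _ /skew_circulantP[a [b [c [d ->]]]]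
          /skew_circulantP[a' [b' [c' [d' ->]]]]
        |_ _ /skew_circulantP[a [b [c [d ->]]]]
          /skew_circulantP[a' [b' [c' [d' ->]]]]]; apply/skew_circulantP.
- exists 1, 0, 0, 0; apply/matrixP => -[[|[|[|[|//]]]] ?] [[|[|[|[|//]]]] ?];
  by rewrite !mxE //= oppr0.
- exists (k * a + a'), (k * b + b'), (k * c + c'), (k * d + d').
  apply/matrixP => -[[|[|[|[|//]]]] ?] [[|[|[|[|//]]]] ?];
  by rewrite !mxE /=; ring.
- exists (a * a' - b * d' - c * c' - d * b'),
    (a * b' + b * a' - c * d' - d * c'),
    (a * c' + b * b' + c * a' - d * d'),
    (a * d' + b * c' + c * b' + d * a').
  apply/matrixP => -[[|[|[|[|//]]]] ?] [[|[|[|[|//]]]] ?];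
  by rewrite !mxE !big_ord_recl big_ord0 !mxE /=; ring.
Qed.

HB.instance Definition _ := GRing.isSubalgClosed.Build R 'M[R]_4 skew_circulant
  skew_circulant_subalg.

Record SkewCirc : Type := MkSkewCirc { Smx :> 'M[R]_4; _ : Smx \in skew_circulant }.

HB.instance Definition _ := [isSub for Smx].
HB.instance Definition _ := [Choice of SkewCirc by <:].
HB.instance Definition _ := [SubChoice_isSubAlgebra of SkewCirc by <:].

Definition psi (x : W R) : SkewCirc :=
  MkSkewCirc (mem_skew_circ (x 0 0) (x 0 1) (x 0 2) (x 0 3)).

End SkewCircAlgebra.

(* Main.v *)
Require Import Defs.
From mathcomp Require Import all_boot all_order all_algebra.
From mathcomp Require Import reals.
From mathcomp Require Import ring.
Import GRing.Theory.
Local Open Scope ring_scope.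

(** With [t] in the role of [Wi], W is R[t]/(t^4 + 1). [psi] sends [Wi] to the skew shift matrix,
    whose fourth power is -1, so products correspond. A skew circulant matrix is determined by its
    first row, hence bijectivity. *)

Lemma psi_bij (R : realType) : bijective (@psi R).
Proof.
exists (fun M : SkewCirc R => row 0 (Smx M)) => [x | M].
  by apply: Wext; rewrite !mxE.
apply: val_inj => /=.
have /skew_circulantP[a [b [c [d ->]]]] := valP M.
by rewrite !mxE.
Qed.

Lemma psi_linear (R : realType) : linear (@psi R).
Proof.
(* The inclusion [Smx] is linear, so the identity can be checked entrywise on matrices. *)
move=> a x y; apply: val_inj; rewrite linearP /=.
apply/matrixP => -[[|[|[|[|//]]]] ?] [[|[|[|[|//]]]] ?];
by rewrite !mxE /=; ring.
Qed.

Lemma psi_monoid_morphism (R : realType) : GRing.monoid_morphism (@psi R).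
Proof.
split=> [|x y]; apply: val_inj.
  rewrite rmorph1 /=; have [-> -> -> ->] := W1E R.
  apply/matrixP => -[[|[|[|[|//]]]] ?] [[|[|[|[|//]]]] ?];
  (* Below the diagonal the entries are negated zero coordinates. *)
  by rewrite !mxE //= oppr0.
(* What remains is sixteen polynomial identities: each entry of the matrix product is, up to sign, a
   coordinate of [x * y]. *)
rewrite rmorphM /=; have [-> -> -> ->] := @WmulE R x y.
apply/matrixP => -[[|[|[|[|//]]]] ?] [[|[|[|[|//]]]] ?];
by rewrite !mxE !big_ord_recl big_ord0 !mxE /=; ring.
Qed.

Theorem theorem3 (R : realType) :
  [/\ bijective (@psi R : W R -> SkewCirc R),
      linear (@psi R : W R -> SkewCirc R) &
      GRing.monoid_morphism (@psi R : W R -> SkewCirc R)].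
Proof.
split; [exact: psi_bij | exact: psi_linear | exact: psi_monoid_morphism].
Qed.
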